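(* Let $b\in SN$. For $\rho>0$, $\mathcal{M}_1(b,\rho)\subset\mathcal{M}(\infty)$, and for $\rho<0$, $\mathcal{M}_1(b,\rho)\subset\mathcal{M}(-\infty)$.
   Context: $\mathbb{R}^+=(0,\infty)$. A positive measurable function $b$ on $\mathbb{R}^+$ is called self-neglecting, $b\in SN$, if $b(x)/x\to 0$ as $x\to\infty$ and $\lim_{x\to\infty}\frac{b(x+y\,b(x))}{b(x)}=1$ locally uniformly in $y\in\mathbb{R}$. For $b\in SN$ and $\rho\in\mathbb{R}$, $\mathcal{M}_1(b,\rho)$ is the set of positive measurable functions $U$ on $\mathbb{R}^+$ such that $\lim_{x\to\infty}\frac{\log U(x)}{\int_a^x b^{-1}(t)\,dt}=\rho$, where $b^{-1}(t)=1/b(t)$, $a\ge 0$ is a fixed real number and $\int_a^x b^{-1}(t)\,dt<\infty$ for every finite $x>a$. $\mathcal{M}(\infty)$ (respectively $\mathcal{M}(-\infty)$) is the class of positive measurable functions $U$ on $\mathbb{R}^+$ with $\lim_{x\to\infty}\frac{\log U(x)}{\log x}=\infty$ (respectively $-\infty$). *)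

(* Defs.v *)
From mathcomp Require Import all_boot all_order all_algebra.
From mathcomp Require Import all_classical all_reals all_analysis.

Set Implicit Arguments.
Unset Strict Implicit.
Unset Printing Implicit Defensive.

Import Order.TTheory GRing.Theory Num.Theory.
Import numFieldNormedType.Exports.

Local Open Scope classical_set_scope.
Local Open Scope ring_scope.

(* Functions on (0, +oo) are represented by total functions R -> R of which
   only the values on `]0, +oo[ matter. *)

(* R with the sigma-algebra of Lebesgue-measurable (not only Borel) sets; it is
   the domain of completed_lebesgue_measure. *)
Notation lebesgueTypeR R := (caratheodory_type (@wlength R idfun)^*%mu).

Definition positive_measurable {R : realType} (f : R -> R) : Prop :=
  measurable_fun (`]0, +oo[%classic : set (lebesgueTypeR R))
    (f : lebesgueTypeR R -> R) /\
  (forall x, 0 < x -> 0 < f x).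

(* Locally uniform convergence in y is convergence in the topology of uniform
   convergence on the compact subsets of R; the limit is in x. *)
Definition self_neglecting {R : realType} (b : R -> R) : Prop :=
  [/\ positive_measurable b,
      b x / x @[x --> +oo] --> (0 : R)
    & {family compact,
        (fun y => b (x + y * b x) / b x) @[x --> +oo] --> (cst 1 : R -> R)}].

(* `]a, x] rather than `[a, x], since b 0 is meaningless when a = 0. *)
Definition base_point {R : realType} (b : R -> R) (a : R) : Prop :=
  0 <= a /\
  (forall x, a < x ->
    (\int[completed_lebesgue_measure]_(t in `]a, x]) ((b t)^-1)%:E < +oo)%E).

Definition M1 {R : realType} (a : R) (b : R -> R) (rho : R) : set (R -> R) :=
  [set U | positive_measurable U /\
    ln (U x) / (\int[completed_lebesgue_measure]_(t in `]a, x]) (b t)^-1)%R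
      @[x --> +oo] --> rho].

Definition Mpinfty {R : realType} : set (R -> R) :=
  [set U | positive_measurable U /\ ln (U x) / ln x @[x --> +oo] --> +oo].

Definition Mninfty {R : realType} : set (R -> R) :=
  [set U | positive_measurable U /\ ln (U x) / ln x @[x --> +oo] --> -oo].

(* Main.v *)
Require Import Defs.
From mathcomp Require Import all_boot all_order all_algebra.
From mathcomp Require Import all_classical all_reals all_analysis.
From mathcomp Require Import measurable_realfun lra.

(** Write I x for the integral of 1/b over (a, x]. The idea is that
    b t = o(t) forces 1/b to exceed every multiple of 1/t eventually, so that
    I x grows faster than every multiple of ln x; hence I x / ln x tends to
    +oo ([integral_inv_dominates_ln] and [cvg_div_ln]). The conclusion follows
    from the factorization
      ln (U x) / ln x = (ln (U x) / I x) * (I x / ln x),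
    where the first factor tends to rho: the product tends to +oo or -oo
    according to the sign of rho ([cvgM_gt0_pinfty]).

    The comparison of I with ln only integrates constants. If 1/b t >= c / t
    for t >= A, then on (x, y] one has 1/b >= c / y, which gives
    I y - I x >= c (y - x) / y ([increment_ge]). When y <= 2 x the right-hand
    side is at least c/2 (ln y - ln x), because ln (y / x) <= (y - x) / x. These
    estimates telescope along a dyadic chain from A to any y
    ([log_growth]). *)

Set Implicit Arguments.
Unset Strict Implicit.
Unset Printing Implicit Defensive.

Import Order.TTheory GRing.Theory Num.Theory.
Import numFieldNormedType.Exports.
Local Open Scope classical_set_scope.
Local Open Scope ring_scope.

(** * Intervals and reciprocals *)

Lemma measurable_itv_lebesgue (R : realType) (i : interval R) :
  measurable ([set` i] : set (lebesgueTypeR R)).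
Proof. by apply: sub_caratheodory; exact: measurable_itv. Qed.

Lemma completed_lebesgue_measure_ocitv (R : realType) (x y : R) : x <= y ->
  (@completed_lebesgue_measure R : {measure set (lebesgueTypeR R) -> \bar R})
    `]x, y]%classic = (y - x)%:E.
Proof.
move=> xy; transitivity (@lebesgue_measure R `]x, y]%classic) => //.
rewrite lebesgue_measure_itv /= lte_fin.
move: xy; rewrite le_eqVlt => /predU1P[->|->//].
by rewrite ltxx subrr.
Qed.

(** On positive reals inversion agrees with the power of exponent -1, which is a
    measurable function on the whole line. *)
Lemma measurable_inv_gt0 d (T : measurableType d) (R : realType) (D : set T)
    (f : T -> R) :
  measurable D -> measurable_fun D f -> (forall x, D x -> 0 < f x) ->
  measurable_fun D (fun x => (f x)^-1).
Proof.
move=> mD mf f0.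
apply: (eq_measurable_fun (fun x => f x `^ (-1))).
  by move=> x /set_mem /f0 fx0; rewrite powR_inv1// ltW.
exact: (measurableT_comp (measurable_powR (-1)) mf).
Qed.

(** * Logarithmic growth from increments *)

(** A lower bound c (y - x) / y on increments costs a factor 2 when compared
    with c (ln y - ln x), as long as y <= 2 x; the increments of F and of ln
    then add up over a chain of at most n doublings when y <= 2 ^ n A. *)
Lemma log_growth (R : realType) (F : R -> R) (A c : R) : 0 < A ->
  0 <= c ->
  (forall x y, A <= x -> x <= y -> c * ((y - x) / y) <= F y - F x) ->
  forall y, A <= y -> c / 2 * (ln y - ln A) <= F y - F A.
Proof.
move=> A0 c0 HF.
have step x y : A <= x -> x <= y -> y <= 2 * x ->
    c / 2 * (ln y - ln x) <= F y - F x.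
  move=> Ax xy y2x; apply: le_trans (HF _ _ Ax xy).
  have x0 : 0 < x by exact: lt_le_trans Ax.
  have y0 : 0 < y by exact: lt_le_trans xy.
  rewrite -mulrA ler_wpM2l// -ln_div ?posrE//.
  have -> : y / x = 1 + (y - x) / x by rewrite mulrBl divff ?gt_eqF// subrKC.
  rewrite (@le_trans _ _ (2^-1 * ((y - x) / x)))//.
    rewrite ler_wpM2l ?invr_ge0// le_ln1Dx//.
    by rewrite (@lt_le_trans _ _ 0)// ?ltrN10// divr_ge0 ?subr_ge0// ltW.
  rewrite mulrCA ler_wpM2l ?subr_ge0// -invfM lef_pV2 ?posrE ?mulr_gt0//.
have ind n y : A <= y -> y <= 2 ^+ n * A -> c / 2 * (ln y - ln A) <= F y - F A.
  elim: n y => [|n IH] y Ay.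
    rewrite expr0 mul1r => yA; have -> : y = A by apply/eqP; rewrite eq_le yA.
    by rewrite !subrr mulr0.
  rewrite exprS -mulrA => yn.
  (* The halfway point y / 2 is truncated at A so that the induction
     hypothesis applies to it. *)
  pose x := Num.max A (y / 2).
  have Ax : A <= x by rewrite le_max lexx.
  have xy : x <= y.
    rewrite ge_max Ay/=; lra.
  have y2x : y <= 2 * x.
    by rewrite -ler_pdivrMl// mulrC le_max lexx orbT.
  have xn : x <= 2 ^+ n * A.
    rewrite ge_max; apply/andP; split; last lra.
    by rewrite ler_peMl ?(ltW A0)// exprn_ege1// ler1n.
  have := IH _ Ax xn; have := step _ _ Ax xy y2x; lra.
move=> y Ay.
pose n := Num.bound (y / A).
apply: (ind n) => //; rewrite -ler_pdivrMr//.
have yA : 0 <= y / A by rewrite divr_ge0 ?ltW// (lt_le_trans A0).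
apply: (le_trans (ltW (archi_boundP yA))).
by rewrite -natrX ler_nat ltnW// ltn_expl.
Qed.

(** The arithmetic behind the choice of the constant 4 K: it yields the slope
    2 K in ln, and half of 2 K q absorbs the cost 2 K p of starting at p as
    soon as q >= 2 p. *)
Lemma le_of_increment_ge (R : realFieldType) (K u v p q : R) :
  0 <= v -> K * (2 * p) <= K * q -> 4 * K / 2 * (q - p) <= u - v -> K * q <= u.
Proof. lra. Qed.

(** * The integral of the reciprocal of b *)

Section lower_bound.
Context {R : realType}.
Variables (b : R -> R) (a : R).
Hypotheses (mb : positive_measurable b) (ha : base_point b a).
Local Notation mu := (@completed_lebesgue_measure R).
Local Notation I x := (\int[mu]_(t in `]a, x]) (b t)^-1)%R.

Lemma integrable_inv_base (x : R) :
  mu.-integrable `]a, x]%classic (EFin \o (fun t => (b t)^-1)).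
Proof.
case: mb ha => mfb b0 [a0 fin].
have b0' t : `]a, x]%classic t -> 0 < b t.
  by rewrite /= in_itv /= => /andP[at_ _]; apply: b0; exact: le_lt_trans at_.
have [xa|ax] := leP x a.
  by rewrite set_itv_ge ?bnd_simp -?leNgt//; exact: integrable_set0.
have mf : measurable_fun (`]a, x]%classic : set (lebesgueTypeR R))
    (fun t : lebesgueTypeR R => (b t)^-1).
  apply: (@measurable_inv_gt0 _ (lebesgueTypeR R)) => //.
    exact: measurable_itv_lebesgue.
  apply: measurable_funS mfb.
    exact: measurable_itv_lebesgue.
  move=> t; rewrite /= !in_itv/= andbT => /andP[at_ _].
  exact: le_lt_trans at_.
apply/integrableP; split; first exact/measurable_EFinP.
under eq_integral => t /set_mem /b0' bt0.
  rewrite /= ger0_norm ?invr_ge0 ?(ltW bt0)//; over.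
exact: fin.
Qed.

Lemma increment_ge (c x y : R) : a <= x -> x <= y ->
  (forall t, x < t <= y -> c <= (b t)^-1) ->
  c * (y - x) <= I y - I x.
Proof.
move=> ax xy cb.
have xyE : `]a, y]%classic = `]a, x] `|` `]x, y] :> set (lebesgueTypeR R).
  by rewrite -itv_bndbnd_setU ?bnd_simp.
have xysub : `]x, y]%classic `<=` (`]a, y]%classic : set (lebesgueTypeR R)).
  by rewrite xyE; exact: subsetUr.
have -> : I y = I x + (\int[mu]_(t in `]x, y]) (b t)^-1)%R.
  rewrite xyE Rintegral_setU//; try exact: measurable_itv_lebesgue.
    by rewrite -xyE; exact: integrable_inv_base.
  apply/disj_setPS => t [/=]; rewrite !in_itv/= => /andP[_ tx] /andP[].
  by rewrite ltNge tx.
rewrite [leRHS]addrC addKr.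
rewrite -(_ : (\int[mu]_(t in `]x, y]) c)%R = c * (y - x)); last first.
  rewrite Rintegral_cst; last exact: measurable_itv_lebesgue.
  by rewrite completed_lebesgue_measure_ocitv.
apply: le_Rintegral.
- exact: measurable_itv_lebesgue.
- apply: measurable_bounded_integrable => //.
  + exact: measurable_itv_lebesgue.
  + by rewrite completed_lebesgue_measure_ocitv// ltry.
  + exact: bounded_cst.
- apply: integrableS (integrable_inv_base y) => //;
    exact: measurable_itv_lebesgue.
- by move=> t; rewrite /= in_itv/=; exact: cb.
Qed.

(** Since b t / t -> 0, eventually 1/b t >= 4 K / t, and the increments of the
    integral satisfy the hypothesis of [log_growth] with c = 4 K. *)
Lemma integral_inv_dominates_ln : b x / x @[x --> +oo] --> (0 : R) ->
  forall K, 0 < K -> \forall x \near +oo, K * ln x <= I x.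
Proof.
move=> bx0 K K0; case: (mb) (ha) => _ b0 [a0 _].
have c0 : 0 < 4 * K by rewrite mulr_gt0.
have ci0 : 0 < (4 * K)^-1 by rewrite invr_gt0.
have [M [_ HM]] := cvgr0_norm_lt _ bx0 _ ci0.
pose A := Num.max (Num.max a 1) (M + 1).
have aA : a <= A by rewrite !le_max lexx.
have A1 : 1 <= A by rewrite !le_max lexx orbT.
have A0 : 0 < A by exact: lt_le_trans A1.
have MA : M < A by rewrite lt_max ltrDl ltr01 orbT.
have incr x y : A <= x -> x <= y -> 4 * K * ((y - x) / y) <= I y - I x.
  move=> Ax xy; rewrite mulrA mulrAC.
  have x0 : 0 < x by exact: lt_le_trans Ax.
  have y0 : 0 < y by exact: lt_le_trans xy.
  apply: increment_ge => //; first exact: le_trans Ax.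
  move=> t /andP[xt ty]; have t0 : 0 < t by exact: lt_trans xt.
  have bt0 := b0 _ t0.
  have := HM t (lt_trans MA (le_lt_trans Ax xt)).
  rewrite /= ger0_norm; last by rewrite divr_ge0 // ltW.
  rewrite ltr_pdivrMr// => bt.
  rewrite -[_ / y]invrK lef_pV2 ?posrE// ?invr_gt0 ?divr_gt0//.
  rewrite (le_trans (ltW bt))// [leRHS]invfM invrK ler_wpM2l// ltW//.
near=> x.
have Ax : A <= x by near: x; apply: nbhs_pinfty_ge; exact: num_real.
(* This amounts to ln x >= 2 ln A, the condition of [le_of_increment_ge]. *)
have AAx : A ^+ 2 <= x by near: x; apply: nbhs_pinfty_ge; exact: num_real.
have growth := log_growth A0 (ltW c0) incr Ax.
have IA0 : 0 <= I A.
  apply: Rintegral_ge0 => t; rewrite /= in_itv/= => /andP[at_ _].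
  by rewrite invr_ge0 ltW// b0// (le_lt_trans a0).
have lnA : 2 * ln A <= ln x.
  have x0 : 0 < x by exact: lt_le_trans Ax.
  by rewrite mulrC mulr_natr -lnXn// ler_ln ?posrE ?exprn_gt0.
exact: le_of_increment_ge IA0 (ler_wpM2l (ltW K0) lnA) growth.
Unshelve. all: by end_near.
Qed.

End lower_bound.

(** * Limits *)

Lemma cvg_div_ln (R : realType) (I : R -> R) :
 (forall K : R, 0 < K -> \forall x \near +oo, K * ln x <= I x) ->
  I x / ln x @[x --> +oo] --> +oo.
Proof.
move=> H; apply/cvgryPge => K.
near=> x.
have lx : 0 < ln x by apply: ln_gt0; near: x; exact: nbhs_pinfty_gt.
rewrite ler_pdivlMr//.
apply: (@le_trans _ _ (Num.max K 1 * ln x)).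
  by rewrite ler_wpM2r ?le_max ?lexx// ltW.
by near: x; apply: H; rewrite lt_max ltr01 orbT.
Unshelve. all: by end_near.
Qed.

Lemma cvgM_gt0_pinfty (R : realType) (f g : R -> R) (l : R) : 0 < l ->
  f x @[x --> +oo] --> l -> g x @[x --> +oo] --> +oo ->
  f x * g x @[x --> +oo] --> +oo.
Proof.
move=> l0 fl gy; have l20 : 0 < l / 2 by rewrite divr_gt0.
have /cvgryPge gge := gy.
apply/cvgryPge => K; near=> x.
apply: (@le_trans _ _ (l / 2 * g x)).
  by rewrite -ler_pdivrMl//; near: x; exact: gge.
apply: ler_wpM2r; first by near: x; exact: gge.
apply/ltW; near: x; apply: (cvgr_gt _ fl); lra.
Unshelve. all: by end_near.
Qed.

Theorem lemma3p5 (R : realType) (b : R -> R) (hb : self_neglecting b)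
    (a : R) (ha : base_point b a) :
  (forall rho : R, 0 < rho -> M1 a b rho `<=` Mpinfty) /\
  (forall rho : R, rho < 0 -> M1 a b rho `<=` Mninfty).
Proof.
have [mb bx0 _] := hb.
have Iy := cvg_div_ln (integral_inv_dominates_ln mb ha bx0).
have /cvgryPge Ige := Iy.
have lnUE (U : R -> R) : \forall x \near +oo,
    ln (U x) / (\int[completed_lebesgue_measure]_(t in `]a, x]) (b t)^-1)%R *
      ((\int[completed_lebesgue_measure]_(t in `]a, x]) (b t)^-1)%R / ln x)
    = ln (U x) / ln x.
  (* The cancelled integral is nonzero: its quotient by ln x is at least 1. *)
  near=> x; rewrite mulrA divfK//; apply/eqP => I0.
  have : 1 <=
    (\int[completed_lebesgue_measure]_(t in `]a, x]) (b t)^-1)%R / ln x.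
    by near: x; exact: Ige.
  by rewrite I0 mul0r ler10.
split => rho rho0 U [mU Urho]; split => //.
  apply: cvg_trans (cvgM_gt0_pinfty rho0 Urho Iy).
  by apply: near_eq_cvg; exact: lnUE.
have rho0' : 0 < - rho by rewrite oppr_gt0.
apply/cvgNry.
apply: cvg_trans (cvgM_gt0_pinfty rho0' (cvgN Urho) Iy).
apply: near_eq_cvg; near=> x; rewrite /= mulNr; congr (- _); near: x; exact: lnUE.
Unshelve. all: by end_near.
Qed.
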